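(* Let $\mathcal{N}[\rho]=\sum_iK_i\rho K_i^\dagger$ be a single-qubit channel. Then the locally entanglement-optimal unraveling of $\mathcal{N}$ for the Bell state (acting on one of its two qubits) is also a Kraus decomposition of $\mathcal{N}$ that minimizes, among all Kraus decompositions $\{K_i\}$ of $\mathcal{N}$, the average unitarity $$\mathrm{unitarity}_{\mathrm{av}}(\{K_i\})=\frac1d\sum_i\|K_i\|_F^2\,\mathrm{unitarity}(K_i),\qquad d=2,$$ where the unitarity of an operator $K$ with singular values $\sigma_1,\dots,\sigma_d$ is $$\mathrm{unitarity}(K)=-\sum_{j=1}^d\left(\frac{\sigma_j}{\|K\|_F}\right)^2\log_2\left(\frac{\sigma_j}{\|K\|_F}\right)^2 .$$
   Context: $\|K\|_F=\sqrt{\mathrm{Tr}[K^\dagger K]}$; $0\log_20=0$ and zero Kraus operators contribute $0$. The Bell state is $|\Phi^+\rangle=\frac{1}{\sqrt2}(|00\rangle+|11\rangle)$. A locally entanglement-optimal unraveling of $\mathcal{N}$ for the Bell state is a Kraus decomposition $\{K_i\}_i$ of $\mathcal{N}$ that minimizes, among all Kraus decompositions of $\mathcal{N}$, the ensemble-averaged entanglement entropy $\sum_ip_iE(|\phi_i\rangle)$, where $p_i=\|(K_i\otimes\mathbb{1})|\Phi^+\rangle\|_2^2$, $|\phi_i\rangle=p_i^{-1/2}(K_i\otimes\mathbb{1})|\Phi^+\rangle$, and $E(|\phi\rangle)=-\mathrm{Tr}[\rho_A\log_2\rho_A]$ with $\rho_A$ the reduced state of $|\phi\rangle$ on the first qubit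 (terms with $p_i=0$ contribute $0$). A Kraus decomposition of $\mathcal{N}$ is any finite family $\{K_i\}$ with $\mathcal{N}[\cdot]=\sum_iK_i(\cdot)K_i^\dagger$. *)

(* Defs.v *)
(* MathComp / MathComp-Analysis; complex scalars are R[i] for R : realType. *)
From mathcomp Require Export all_boot all_order all_algebra.
From mathcomp Require Export reals exp.
From mathcomp Require Export complex mxtens.

Set Implicit Arguments.
Unset Strict Implicit.
Unset Printing Implicit Defensive.

Import Order.TTheory GRing.Theory Num.Theory.

Local Open Scope ring_scope.
Local Open Scope complex_scope.
Local Open Scope sesquilinear_scope.

(* [ln] vanishes on nonpositive reals, so [log2 0 = 0]; the convention
   0 log2 0 = 0 then holds for every product [x * log2 x] below. *)
Definition log2 (R : realType) (x : R) : R := ln x / ln 2.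

(* Spectral functional calculus, meaningful for positive semidefinite [A]. By
   [orthomx_spectralP], [A = invmx P *m diag_mx (spectral_diag A) *m P] with
   [P := spectralmx A] unitary. By the convention above, the logarithm is set
   to 0 on the kernel of [A]. *)
Definition mxlog2 (R : realType) (d : nat) (A : 'M[R[i]]_d) : 'M[R[i]]_d :=
  invmx (spectralmx A)
    *m diag_mx (map_mx (fun z => (log2 (complex.Re z))%:C) (spectral_diag A))
    *m spectralmx A.

(* The trace is real for positive semidefinite [rho]. *)
Definition von_neumann_entropy (R : realType) (d : nat) (rho : 'M[R[i]]_d) : R :=
  - complex.Re (\tr (rho *m mxlog2 rho)).

(* Partial trace over the second tensor factor, in the indexing of [*t]. *)
Definition reduced_state1 (R : realType) (d1 d2 : nat)
    (rho : 'M[R[i]]_(d1 * d2)) : 'M[R[i]]_d1 :=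
  \matrix_(i, j) \sum_(k < d2) rho (mxtens_index (i, k)) (mxtens_index (j, k)).

Definition entanglement_entropy (R : realType) (d1 d2 : nat)
    (phi : 'cV[R[i]]_(d1 * d2)) : R :=
  von_neumann_entropy (reduced_state1 (phi *m phi ^t*)).

Definition norm2 (R : realType) (d : nat) (v : 'cV[R[i]]_d) : R :=
  Num.sqrt (\sum_i complex.Re `|v i 0| ^+ 2).

Definition normF (R : realType) (d : nat) (K : 'M[R[i]]_d) : R :=
  Num.sqrt (complex.Re (\tr (K ^t* *m K))).

Definition ket (R : realType) (d : nat) (i : 'I_d) : 'cV[R[i]]_d :=
  delta_mx i 0.

Definition bell_state (R : realType) : 'cV[R[i]]_(2 * 2) :=
  ((Num.sqrt 2)^-1 : R)%:C *: (ket R 0 *t ket R 0 + ket R 1 *t ket R 1).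

Definition trace_preserving (R : realType) (d : nat)
    (N : 'M[R[i]]_d -> 'M[R[i]]_d) : Prop :=
  forall rho, \tr (N rho) = \tr rho.

Definition kraus_decomposition (R : realType) (d : nat)
    (N : 'M[R[i]]_d -> 'M[R[i]]_d) (n : nat) (K : 'I_n -> 'M[R[i]]_d) : Prop :=
  forall rho, N rho = \sum_(i < n) K i *m rho *m (K i) ^t*.

(* The competitors range over Kraus decompositions of arbitrary finite size. *)
Definition minimizes_among_kraus (R : realType) (d : nat)
    (N : 'M[R[i]]_d -> 'M[R[i]]_d)
    (cost : forall m : nat, ('I_m -> 'M[R[i]]_d) -> R)
    (n : nat) (K : 'I_n -> 'M[R[i]]_d) : Prop :=
  kraus_decomposition N K /\
  forall (m : nat) (L : 'I_m -> 'M[R[i]]_d),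
    kraus_decomposition N L -> cost n K <= cost m L.

Definition local_apply (R : realType) (d1 d2 : nat) (K : 'M[R[i]]_d1)
    (psi : 'cV[R[i]]_(d1 * d2)) : 'cV[R[i]]_(d1 * d2) :=
  (K *t (1%:M : 'M[R[i]]_d2)) *m psi.

Definition branch_prob (R : realType) (d1 d2 : nat) (K : 'M[R[i]]_d1)
    (psi : 'cV[R[i]]_(d1 * d2)) : R :=
  norm2 (local_apply K psi) ^+ 2.

(* This is 0 when the branch has probability 0, since [0^-1 = 0]. *)
Definition branch_state (R : realType) (d1 d2 : nat) (K : 'M[R[i]]_d1)
    (psi : 'cV[R[i]]_(d1 * d2)) : 'cV[R[i]]_(d1 * d2) :=
  ((Num.sqrt (branch_prob K psi))^-1)%:C *: local_apply K psi.

Definition average_entanglement (R : realType) (d1 d2 : nat)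
    (psi : 'cV[R[i]]_(d1 * d2)) (n : nat) (K : 'I_n -> 'M[R[i]]_d1) : R :=
  \sum_(i < n) branch_prob (K i) psi * entanglement_entropy (branch_state (K i) psi).

Definition locally_entanglement_optimal (R : realType) (d1 d2 : nat)
    (psi : 'cV[R[i]]_(d1 * d2)) (N : 'M[R[i]]_d1 -> 'M[R[i]]_d1)
    (n : nat) (K : 'I_n -> 'M[R[i]]_d1) : Prop :=
  minimizes_among_kraus N (average_entanglement psi) K.

(* The square roots of the eigenvalues of [K ^t* *m K], with multiplicity. *)
Definition singular_value (R : realType) (d : nat) (K : 'M[R[i]]_d)
    (j : 'I_d) : R :=
  Num.sqrt (complex.Re (spectral_diag (K ^t* *m K) 0 j)).

Definition unitarity (R : realType) (d : nat) (K : 'M[R[i]]_d) : R :=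
  - \sum_(j < d) (singular_value K j / normF K) ^+ 2
                 * log2 ((singular_value K j / normF K) ^+ 2).

Definition unitarity_av (R : realType) (d : nat) (n : nat)
    (K : 'I_n -> 'M[R[i]]_d) : R :=
  d%:R^-1 * \sum_(i < n) normF (K i) ^+ 2 * unitarity (K i).

(* Main.v *)
Require Import Defs.

Set Implicit Arguments.
Unset Strict Implicit.
Unset Printing Implicit Defensive.

Import Order.TTheory GRing.Theory Num.Theory.

Local Open Scope ring_scope.
Local Open Scope complex_scope.
Local Open Scope sesquilinear_scope.

(** For every operator [K] on a qubit, [(K (x) 1)] applied to the Bell state has
    squared norm [normF K ^+ 2 / 2] and, once normalized, reduced state
    [K K^* / normF K ^+ 2].  As [K K^*] and [K^* K] have the same characteristic
    polynomial, the entropy of this state is the Shannon entropy of the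
    normalized squared singular values of [K], i.e. its unitarity.  The two
    cost functions therefore agree on every finite family of operators. *)

(* Both sides equal the determinant of the block matrix [[X, A], [B, 1]]. *)
Lemma char_poly_mulmxC (F : fieldType) n (A B : 'M[F]_n) :
  char_poly (A *m B) = char_poly (B *m A).
Proof.
pose a := map_mx (@polyC F) A; pose b := map_mx (@polyC F) B.
pose M : 'M_(n + n) := block_mx ('X%:M) a b 1%:M.
have detAB : \det M = char_poly (A *m B).
  have : block_mx 1%:M (- a) 0 1%:M *m M = block_mx ('X%:M - a *m b) 0 b 1%:M.
    by rewrite mulmx_block !mul1mx !mul0mx !mulmx1 !add0r mulNmx addrN.
  move=> /(congr1 determinant).
  rewrite det_mulmx det_ublock det_lblock !det1 !mulr1 mul1r => ->.
  by rewrite /char_poly /char_poly_mx map_mxM.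
have : block_mx 1%:M 0 (- b) 'X%:M *m M = block_mx 'X%:M a 0 ('X%:M - b *m a).
  rewrite mulmx_block !mul1mx !mul0mx !mulmx1 !addr0 !mulNmx.
  by rewrite mul_mx_scalar mul_scalar_mx addNr [- _ + _]addrC.
move=> /(congr1 determinant).
rewrite det_mulmx det_ublock det_lblock det1 mul1r detAB det_scalar.
(* The second elimination multiplies both determinants by ['X ^+ n], which is nonzero and
   cancels. *)
move=> /mulfI ->; first by rewrite /char_poly /char_poly_mx map_mxM.
by rewrite expf_neq0 // polyX_eq0.
Qed.

Lemma char_poly_conj_diag (F : fieldType) n (P : 'M[F]_n) (v : 'rV[F]_n) :
  P \in unitmx ->
  char_poly (invmx P *m diag_mx v *m P) = \prod_j ('X - (v 0 j)%:P).
Proof.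
move=> Pu; rewrite -mulmxA char_poly_mulmxC -mulmxA mulmxV // mulmx1.
rewrite char_poly_trig ?diag_mx_is_trig //.
by apply: eq_bigr => j _; rewrite mxE eqxx mulr1n.
Qed.

(** Both characteristic polynomials split into linear factors, and unique factorization makes the
    two lists of roots permutations of each other. The order of the entries of [spectral_diag] is
    not controlled, so only such symmetric sums can be compared. *)
Lemma sum_spectral_diag (C : numClosedFieldType) (V : nmodType) n
    (A P : 'M[C]_n) (v : 'rV[C]_n) (f : C -> V) :
  A \is normalmx -> P \in unitmx ->
  char_poly A = char_poly (invmx P *m diag_mx v *m P) ->
  \sum_j f (spectral_diag A 0 j) = \sum_j f (v 0 j).
Proof.
move=> /orthomx_spectralP An Pu; rewrite {1}An.
rewrite !char_poly_conj_diag ?spectral_unit // => eqp.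
rewrite -(big_map (spectral_diag A 0) predT f) -(big_map (v 0) predT f) /=.
apply: perm_big.
by apply: prod_XsubC_eq; rewrite !big_map eqp.
Qed.

Section Gram.
Variables (R : realType) (d : nat).
Implicit Types (K : 'M[R[i]]_d) (A : 'M[R[i]]_d).

(** Cyclicity of the trace cancels [spectralmx A] against its inverse; each logarithm is real, so
    real parts multiply. *)
Lemma von_neumann_entropyE A : A \is normalmx ->
  von_neumann_entropy A =
  - \sum_j complex.Re (spectral_diag A 0 j)
           * log2 (complex.Re (spectral_diag A 0 j)).
Proof.
move=> /orthomx_spectralP An; rewrite /von_neumann_entropy /mxlog2.
rewrite {1}An; set P := spectralmx A; set D := diag_mx _; set E := diag_mx _.
have Pu : P \in unitmx by exact: spectral_unit.
rewrite !mulmxA mxtrace_mulC !mulmxA mulmxV // mul1mx mulmxK //.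
rewrite mulmx_diag mxtrace_diag; congr (- _).
rewrite (raddf_sum (@complex.Re R)); apply: eq_bigr => j _.
by rewrite !mxE; case: (spectral_diag A 0 j) => a b /=; rewrite mulr0 subr0.
Qed.

Lemma mulmx_adj_hermsym K : K *m K ^t* \is hermsymmx.
Proof.
by apply/is_hermitianmxP; rewrite expr0 scale1r trmx_mul map_mxM /= trmxCK.
Qed.

(** With [P] the diagonalizing unitary, the eigenvalue is a diagonal entry of the Gram matrix of the
    rows of [P *m K ^t*], hence a sum of squared moduli. This lets squaring undo the square root in
    [singular_value]. *)
Lemma spectral_diag_gram_ge0 K j : 0 <= spectral_diag (K ^t* *m K) 0 j.
Proof.
set A := K ^t* *m K; set P := spectralmx A.
have An : A \is normalmx.
  by rewrite /A -{2}[K]trmxCK hermitian_normalmx // mulmx_adj_hermsym.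
have Pu : P \is unitarymx := spectral_unitarymx A.
have -> : spectral_diag A 0 j = (P *m A *m P ^t*) j j.
  rewrite -invmx_unitary // {2}(orthomx_spectralP An) -/P !mulmxA.
  rewrite mulmxV ?unitarymx_unit // mul1mx mulmxK ?unitarymx_unit //.
  by rewrite mxE eqxx mulr1n.
have -> : P *m A *m P ^t* = (P *m K ^t*) *m (P *m K ^t*) ^t*.
  by rewrite trmx_mul map_mxM /= trmxCK !mulmxA.
rewrite mxE; apply: sumr_ge0 => k _.
by rewrite [X in _ * X]mxE [X in _ * X^*%C]mxE mul_conjC_ge0.
Qed.

Lemma normF_sqr K : normF K ^+ 2 = \sum_i \sum_j (complex.Re `|K i j|) ^+ 2.
Proof.
have trE : complex.Re (\tr (K ^t* *m K)) = \sum_i \sum_j (complex.Re `|K i j|) ^+ 2.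
  rewrite /mxtrace raddf_sum exchange_big; apply: eq_bigr => j _.
  rewrite mxE raddf_sum; apply: eq_bigr => i _.
  by rewrite !mxE mulrC -normCK normc_def -rmorphXn.
rewrite /normF sqr_sqrtr trE // sumr_ge0 // => i _; rewrite sumr_ge0 // => j _.
exact: sqr_ge0.
Qed.

Lemma von_neumann_entropy_adj K :
  von_neumann_entropy ((normF K ^+ 2)^-1%:C *: (K *m K ^t*)) = unitarity K.
Proof.
set c := (normF K ^+ 2)^-1; set A := K ^t* *m K.
have An : A \is normalmx.
  by rewrite /A -{2}[K]trmxCK hermitian_normalmx // mulmx_adj_hermsym.
have rhon : c%:C *: (K *m K ^t*) \is normalmx.
  apply/hermitian_normalmx/is_hermitianmxP; rewrite expr0 scale1r.
  rewrite linearZ map_mxZ /= {1}(is_hermitianmxP _ _ _ (mulmx_adj_hermsym K)).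
  by rewrite expr0 scale1r; congr (_ *: _); apply/esym/CrealP; rewrite complex_real.
rewrite von_neumann_entropyE // /unitarity; congr (- _).
pose f (z : R[i]) := complex.Re z * log2 (complex.Re z).
rewrite (@sum_spectral_diag _ _ _ _ (spectralmx A) (c%:C *: spectral_diag A) f).
- apply: eq_bigr => j _; rewrite /f mxE /singular_value -/A exprMn exprVn -/c.
  have := spectral_diag_gram_ge0 K j; rewrite -/A.
  case: (spectral_diag A 0 j) => x y; rewrite lecE /= => /andP[_ x0].
  by rewrite mul0r subr0 sqr_sqrtr // [c * x]mulrC.
- exact: rhon.
- exact: spectral_unit.
rewrite scalemxAl char_poly_mulmxC -scalemxAr.
by rewrite linearZ /= -scalemxAr -scalemxAl -(orthomx_spectralP An).
Qed.

End Gram.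

Section Bell.
Variable R : realType.
Implicit Type K : 'M[R[i]]_2.

(** The Bell state turns an operator into its vectorization: the component with second index [k]
    picks column [k] of [K]. *)
Lemma local_apply_bellE K i k :
  local_apply K (bell_state R) (mxtens_index (i, k)) 0
  = (Num.sqrt 2)^-1%:C * K i k.
Proof.
rewrite /local_apply /bell_state -scalemxAr mulmxDr mxE; congr (_ * _).
(* The column index must also be a tensor index for [tensmxE] to apply. *)
have e0 : (0 : 'I_1) = mxtens_index (0 : 'I_1, 0 : 'I_1) by exact: val_inj.
have tE j :
    (K *t 1%:M *m (ket R j *t ket R j) : 'M_(2 * 2, 1 * 1)) (mxtens_index (i, k)) 0
    = K i j * (k == j)%:R.
  by rewrite e0 tensmx_mul tensmxE mul1mx -colE !mxE eqxx andbT.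
rewrite mxE; apply: (etrans (congr2 +%R (tE 0) (tE 1))).
case: k {tE} => [[|[|//]]] k2; rewrite -?val_eqE /= ?mulr0 ?mulr1 ?addr0 ?add0r.
  by congr (K i _); apply: val_inj.
by congr (K i _); apply: val_inj.
Qed.

Lemma branch_prob_bell K : branch_prob K (bell_state R) = 2^-1 * normF K ^+ 2.
Proof.
have norm_scale (z : R[i]) :
    complex.Re `|(Num.sqrt 2)^-1%:C * z| = (Num.sqrt 2)^-1 * complex.Re `|z|.
  rewrite normrM ger0_norm ?ler0c ?invr_ge0 ?sqrtr_ge0 //.
  by rewrite [`|z|]normc_def -rmorphM.
have normE : \sum_i (complex.Re `|local_apply K (bell_state R) i 0|) ^+ 2
    = 2^-1 * normF K ^+ 2.
  rewrite (reindex (@mxtens_index 2 2)); last first.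
    by exists (@mxtens_unindex 2 2) => u _; rewrite (mxtens_indexK, mxtens_unindexK).
  rewrite normF_sqr mulr_sumr.
  under [RHS]eq_bigr do rewrite mulr_sumr.
  rewrite pair_big; apply: eq_bigr => -[i k] _.
  by rewrite local_apply_bellE norm_scale exprMn exprVn sqr_sqrtr.
by rewrite /branch_prob /norm2 sqr_sqrtr normE // mulr_ge0 ?invr_ge0 ?sqr_ge0 // ler0n.
Qed.

Lemma reduced_branch_state_bell K :
  let phi := branch_state K (bell_state R) in
  reduced_state1 (phi *m phi ^t*) = (normF K ^+ 2)^-1%:C *: (K *m K ^t*).
Proof.
move=> phi; set c := _^-1.
(* Here [a] collects the normalizations of the branch and of the Bell state. Since [0^-1 = 0], the
   identity [a * a = c] also covers [K = 0]. *)
have [a aa phiE] : exists2 a : R, a * a = c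
    & forall i k, phi (mxtens_index (i, k)) 0 = a%:C * K i k.
  pose p := branch_prob K (bell_state R).
  exists ((Num.sqrt p)^-1 * (Num.sqrt 2)^-1); last first.
    by move=> i k; rewrite mxE local_apply_bellE mulrA -rmorphM.
  have p_ge0 : 0 <= p by exact: sqr_ge0.
  rewrite -expr2 exprMn !exprVn (sqr_sqrtr p_ge0) (sqr_sqrtr (ler0n R 2)).
  by rewrite -invfM /p branch_prob_bell mulrAC mulVf ?mul1r ?pnatr_eq0.
have a_conj : (a%:C : R[i])^*%R = a%:C by apply/CrealP/complex_realP; exists a.
apply/matrixP => i j; rewrite !mxE mulr_sumr; apply: eq_bigr => k _.
rewrite mxE big_ord1 [phi ^t* _ _]mxE [phi^T _ _]mxE !phiE.
rewrite [(K ^t*) _ _]mxE [K^T _ _]mxE rmorphM /= a_conj.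
by rewrite -aa rmorphM mulrACA; congr (_ * _).
Qed.

(** The factor [2^-1] in each branch probability is the prefactor [d%:R^-1] of [unitarity_av]. *)
Lemma average_entanglement_bell n (K : 'I_n -> 'M[R[i]]_2) :
  average_entanglement (bell_state R) K = unitarity_av K.
Proof.
rewrite /average_entanglement /unitarity_av mulr_sumr; apply: eq_bigr => i _.
rewrite branch_prob_bell /entanglement_entropy reduced_branch_state_bell.
by rewrite von_neumann_entropy_adj -mulrA; congr (_ * _).
Qed.

End Bell.

Theorem corollary3 (R : realType)
    (N : 'M[R[i]]_2 -> 'M[R[i]]_2)
    (n0 : nat) (K0 : 'I_n0 -> 'M[R[i]]_2)
    (hK0 : kraus_decomposition N K0)
    (hN : trace_preserving N)
    (n : nat) (K : 'I_n -> 'M[R[i]]_2)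
    (hK : locally_entanglement_optimal (bell_state R) N K) :
  minimizes_among_kraus N (@unitarity_av R 2) K.
Proof.
case: hK => decK minK; split=> // m L decL.
by rewrite -!average_entanglement_bell minK.
Qed.
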